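(* Let $B\subset\mathbb{R}^3$ be an open set, let $f=(f^4,f^5,f^6,f^7):B\to T^4$ be a smooth map, let $X=B\times T^4$ carry the flat metric and the standard $G_2$-structure $\varphi$, and let $$F^S_\nabla=\sqrt{-1}\sum_{i=1}^3\sum_{a=4}^7\frac{\partial f^a}{\partial x^i}\,dx^i\wedge dy^a$$ be the curvature of the real Fourier--Mukai transform of the graph of $f$. Then, at every point of $X$, $$\Big(1+\tfrac12\langle(F^S_\nabla)^2,*\varphi\rangle\Big)^2+\Big|*\varphi\wedge F^S_\nabla+\tfrac16(F^S_\nabla)^3\Big|^2+\tfrac14\big|\varphi\wedge*\big((F^S_\nabla)^2\big)\big|^2=\det\Big(\mathrm{id}_{TX}+(-\sqrt{-1}F^S_\nabla)^\sharp\Big),$$ where $(-\sqrt{-1}F^S_\nabla)^\sharp$ is the skew-symmetric endomorphism of $TX$ defined by $\langle(-\sqrt{-1}F^S_\nabla)^\sharp u,v\rangle=-\sqrt{-1}F^S_\nabla(u,v)$ for $u,v\in TX$.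
   Context: $T^4=\mathbb{R}^4/(2\pi\mathbb{Z})^4$. Coordinates on $B$ are $(x^1,x^2,x^3)$ and on $T^4$ are $(y^4,\dots,y^7)$; $X=B\times T^4$ has the flat metric $\langle\cdot,\cdot\rangle=\sum(dx^i)^2+\sum(dy^a)^2$ and orientation $dx^{123}\wedge dy^{4567}$; $*$ is the Hodge star; powers of forms are wedge powers and $dx^{ij}=dx^i\wedge dx^j$, etc. Set $\omega_1=dy^{45}+dy^{67}$, $\omega_2=dy^{46}+dy^{75}$, $\omega_3=-(dy^{47}+dy^{56})$. The standard $G_2$-structure and its Hodge dual are $\varphi=dx^{123}+\sum_{i=1}^3dx^i\wedge\omega_i$ and $*\varphi=dy^{4567}+dx^{12}\wedge\omega_3+dx^{23}\wedge\omega_1+dx^{31}\wedge\omega_2$. Inner products on $k$-forms are those for which the wedge products $e^{i_1}\wedge\cdots\wedge e^{i_k}$ ($i_1<\cdots<i_k$) of an orthonormal coframe are orthonormal; for a purely imaginary form, $|\sqrt{-1}\alpha|=|\alpha|$ with $\alpha$ real. The real Fourier--Mukai transform of the graph of $f$ is the Hermitian connection $d+\sqrt{-1}\sum_{a=4}^7f^ady^a$ of the trivial complex line bundle over $B\times(T^4)^*\cong X$. (The components $f^a$ are defined modulo $2\pi$, so their derivatives are well-defined functions on $B$.) *)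

(* Defs.v *)
From HB Require Import structures.
From mathcomp Require Import all_boot all_order all_algebra.
From mathcomp Require Import zify ring complex.
From mathcomp Require Import all_classical all_reals all_analysis.

Set Implicit Arguments.
Unset Strict Implicit.
Unset Printing Implicit Defensive.

Import Order.TTheory GRing.Theory Num.Theory.
Import numFieldNormedType.Exports.

Local Open Scope complex_scope.
Local Open Scope ring_scope.

Reserved Notation "a \w b" (at level 40, left associativity).

Section Exterior.
Variables (K : comNzRingType) (n : nat).

(* A (mixed-degree) exterior form on K^n, given by its coefficients in the
   basis e^S = e^{i_1} /\ ... /\ e^{i_k}, where S = {i_1 < ... < i_k}. *)
Definition ext_form := {ffun {set 'I_n} -> K^o}.

Definition basis_form (S : {set 'I_n}) : ext_form := [ffun T => (T == S)%:R].

Definition covector (i : 'I_n) : ext_form := basis_form [set i].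

(* For disjoint S and T, e^S /\ e^T = wsign S T * e^(S :|: T): the exponent
   counts the transpositions needed to sort the concatenation of S and T. *)
Definition wsign (S T : {set 'I_n}) : K :=
  (-1) ^+ #|[set p : 'I_n * 'I_n |
               [&& p.1 \in S, p.2 \in T & (p.2 < p.1)%N]]|.

Definition wedge_form (a b : ext_form) : ext_form :=
  [ffun S : {set 'I_n} =>
    \sum_(T : {set 'I_n} | T \subset S)
      wsign T (S :\: T) * (a T * b (S :\: T))].

Definition wedge_pow (a : ext_form) (k : nat) : ext_form :=
  iter k (wedge_form a) (basis_form finset.set0).

(* The K-linear Hodge star of the metric for which the e^i are orthonormal and
   of the orientation e^1 /\ ... /\ e^n, i.e.
   * e^S = wsign S (~: S) e^(~: S), so that e^S /\ * e^S is the volume form. *)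
Definition hodge (a : ext_form) : ext_form :=
  [ffun S : {set 'I_n} => wsign (~: S) S * a (~: S)].

End Exterior.

Notation "a \w b" := (wedge_form a b) : ring_scope.

Lemma wedge_basis_form (K : comNzRingType) n (S T : {set 'I_n}) :
  [disjoint S & T] ->
  basis_form K S \w basis_form K T = wsign K S T *: basis_form K (S :|: T).
Proof.
move=> dST; apply/ffunP => U; rewrite !ffunE.
rewrite (bigID (fun V => V == S)) /= [X in _ + X]big1 ?addr0; last first.
  by move=> V /andP[_ /negbTE h]; rewrite ffunE h mul0r mulr0.
case: (U =P (S :|: T)) => [->|UN].
  rewrite (big_pred1 S); last first.
    by move=> V /=; case: eqP => [->|]; rewrite ?andbF// finset.subsetUl.
  have -> : (S :|: T) :\: S = T.
    rewrite finset.setDUl finset.setDv finset.set0U.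
    by apply/finset.setDidPl; rewrite disjoint_sym.
  by rewrite !ffunE !eqxx !mulr1 /GRing.scale /= mulr1.
rewrite big1 ?scaler0// => V /andP[VU /eqP E]; subst V.
rewrite !ffunE eqxx mul1r; case: eqP => [h|_]; last by rewrite mulr0.
by case: UN; rewrite -h finset.setDE finset.setUIr finset.setUCr finset.setIT;
  apply/esym/finset.setUidPr.
Qed.

Section ComplexForms.
Variables (R : realType) (n : nat).

(* The Hermitian extension of the real inner product for which the basis_form S
   are orthonormal; in particular |sqrt(-1) a| = |a|. *)
Definition form_dot (a b : ext_form R[i] n) : R[i] := \sum_S a S * (b S)^*.

Definition form_norm (a : ext_form R[i] n) : R[i] := sqrtC (form_dot a a).

(* w(u, v), normalised by (e^j /\ e^k)(u, v) = u_j v_k - u_k v_j *)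
Definition eval2 (w : ext_form R[i] n) (u v : 'cV[R]_n) : R[i] :=
  \sum_(j < n) \sum_(k < n | (j < k)%N)
    w [set j; k] * (u j 0 * v k 0 - u k 0 * v j 0)%:C.

(* A is the (real) endomorphism w^# determined by <w^# u, v> = w(u, v) *)
Definition is_sharp (w : ext_form R[i] n) (A : 'M[R]_n) : Prop :=
  forall u v : 'cV[R]_n, (((A *m u)^T *m v) 0 0)%:C = eval2 w u v.

Lemma is_sharp_unique (w : ext_form R[i] n) A A' :
  is_sharp w A -> is_sharp w A' -> A = A'.
Proof.
move=> wA wA'; apply/matrixP => i j.
suff E B : is_sharp w B -> (B i j)%:C = eval2 w (delta_mx j 0) (delta_mx i 0).
  by have := E _ wA; rewrite -(E _ wA') => -[].
move=> /(_ (delta_mx j 0) (delta_mx i 0)) <-.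
by rewrite -!colE !mxE.
Qed.

Lemma is_sharp_exists (w : ext_form R[i] n) :
  (forall S, w S \is Num.real) -> exists A, is_sharp w A.
Proof.
move=> wr; pose a j k : R := complex.Re (w [set j; k]).
have aC j k : a j k = a k j by rewrite /a finset.setUC.
have wE j k : w [set j; k] = (a j k)%:C by rewrite /a RRe_real.
exists (\matrix_(i, j) if (j < i)%N then a j i
                       else if (i < j)%N then - a j i else 0) => u v.
rewrite /eval2; under eq_bigr do under eq_bigr do rewrite wE -rmorphM.
under eq_bigr do rewrite -rmorph_sum.
rewrite -rmorph_sum; congr (_%:C); rewrite mxE.
under eq_bigr do rewrite !mxE mulr_suml.
transitivity (\sum_(i < n) \sum_(j < n | (j < i)%N) a j i * (u j 0 * v i 0)
  - \sum_(i < n) \sum_(j < n | (i < j)%N) a j i * (u j 0 * v i 0)).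
  rewrite -sumrB; apply: eq_bigr => i _.
  rewrite [X in X - _]big_mkcond [X in _ - X]big_mkcond -sumrB.
  apply: eq_bigr => j _; rewrite mxE.
  by case: ltngtP => _; ring.
rewrite (exchange_big_dep xpredT)//= -sumrB; apply: eq_bigr => j _.
by rewrite -sumrB; apply: eq_bigr => k _; rewrite [a k j]aC; ring.
Qed.

Lemma real_wedge (a b : ext_form R[i] n) :
  (forall S, a S \is Num.real) ->
  (forall S, b S \is Num.real) -> forall S, (a \w b) S \is Num.real.
Proof.
move=> ar br S; rewrite ffunE; apply: rpred_sum => T _.
by rewrite !rpredM// /wsign rpredX// rpredN rpred1.
Qed.

End ComplexForms.

Section G2.
Variable K : comNzRingType.

(* Orthonormal coframe of B x T^4, numbered from 1: e7 1, e7 2, e7 3 are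
   dx^1, dx^2, dx^3, and e7 4, ..., e7 7 are dy^4, ..., dy^7. *)
Definition e7 (k : nat) : ext_form K 7 := covector K (inord k.-1).

Definition omega1 : ext_form K 7 := e7 4 \w e7 5 + e7 6 \w e7 7.
Definition omega2 : ext_form K 7 := e7 4 \w e7 6 + e7 7 \w e7 5.
Definition omega3 : ext_form K 7 := - (e7 4 \w e7 7 + e7 5 \w e7 6).

Definition phi : ext_form K 7 :=
  e7 1 \w e7 2 \w e7 3
  + (e7 1 \w omega1 + e7 2 \w omega2 + e7 3 \w omega3).

End G2.

Local Open Scope classical_set_scope.

Section Torus.
Variable R : realType.

Definition lattice_rel (u v : 'rV[R]_4) : bool :=
  `[< exists k : 'rV[int]_4, u - v = (2 * pi) *: map_mx intr k >].

Fact lattice_rel_refl : reflexive lattice_rel.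
Proof.
move=> u; apply/asboolP; exists 0.
by rewrite subrr; apply/matrixP => i j; rewrite !mxE /= mulr0.
Qed.

Fact lattice_rel_sym : symmetric lattice_rel.
Proof.
suff H u v : lattice_rel u v -> lattice_rel v u.
  by move=> u v; apply/idP/idP; apply: H.
move=> /asboolP[k Hk]; apply/asboolP; exists (- k).
rewrite -opprB Hk -scalerN; congr (_ *: _).
by apply/matrixP => i j; rewrite !mxE rmorphN.
Qed.

Fact lattice_rel_trans : transitive lattice_rel.
Proof.
move=> v u w /asboolP[k Hk] /asboolP[l Hl]; apply/asboolP; exists (k + l).
rewrite -[u](subrK v) -addrA Hk Hl -scalerDr; congr (_ *: _).
by apply/matrixP => i j; rewrite !mxE rmorphD.
Qed.

Canonical lattice_equiv :=
  EquivRel lattice_rel lattice_rel_refl lattice_rel_sym lattice_rel_trans.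

Definition torus4 := {eq_quot lattice_equiv}%qT.

Definition to_torus4 (u : 'rV[R]_4) : torus4 := \pi_torus4%qT u.

Lemma to_torus4P (u v : 'rV[R]_4) :
  to_torus4 u = to_torus4 v <->
  exists k : 'rV[int]_4, u - v = (2 * pi) *: map_mx intr k.
Proof. by split => [/eqmodP/asboolP|/asboolP H]; [|apply/eqmodP]. Qed.

End Torus.

Section Smooth.
Variable R : realType.

Definition partial n (i : 'I_n.+1) (g : 'rV[R]_n.+1 -> R)
    (x : 'rV[R]_n.+1) : R :=
  'D_(delta_mx 0 i : 'rV[R]_n.+1) g x.

Fixpoint Ck_on n (k : nat) (U : set 'rV[R]_n.+1) (g : 'rV[R]_n.+1 -> R) :
    Prop :=
  (forall x, U x -> {for x, continuous g}) /\
  if k is k'.+1 then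
    forall i : 'I_n.+1,
      (forall x, U x -> derivable g x (delta_mx 0 i : 'rV[R]_n.+1)) /\
      Ck_on k' U (partial i g)
  else True.

Definition smooth_on n (U : set 'rV[R]_n.+1) (g : 'rV[R]_n.+1 -> R) : Prop :=
  forall k, Ck_on k U g.

(* g is a smooth lift of f to R^4 on some neighbourhood of x *)
Definition local_lift (f : 'rV[R]_3 -> torus4 R) (x : 'rV[R]_3)
    (g : 'rV[R]_3 -> 'rV[R]_4) : Prop :=
  exists U : set 'rV[R]_3,
    [/\ open_nbhs x U,
        forall a, smooth_on U (fun z => g z 0 a) &
        forall z, U z -> to_torus4 (g z) = f z].

(* The covering R^4 -> T^4 is a local diffeomorphism, so a map to T^4 is
   smooth on the open set B if and only if it lifts smoothly near each point. *)
Definition smooth_to_torus (B : set 'rV[R]_3) (f : 'rV[R]_3 -> torus4 R) :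
    Prop :=
  forall x, B x -> exists g, local_lift f x g.

(* df^a/dx^i at x, computed with any smooth lift of f near x; it does not
   depend on the lift by torus_partialE *)
Definition torus_partial (f : 'rV[R]_3 -> torus4 R) (i : 'I_3) (a : 'I_4)
    (x : 'rV[R]_3) : R :=
  partial i (fun z => xget (fun=> 0) (local_lift f x) z 0 a) x.

Lemma derive_shift_ext (V W : normedModType R) (f : V -> R) (g : W -> R)
    (v x : V) (w y : W) :
  (forall h : R, f (h *: v + x) - f x = g (h *: w + y) - g y) ->
  'D_v f x = 'D_w g y.
Proof.
move=> fg; rewrite /derive.
suff -> : (fun h : R => h^-1 *: ((f \o shift x) (h *: v) - f x)) =
          (fun h : R => h^-1 *: ((g \o shift y) (h *: w) - g y)) by [].
by apply/funext => h /=; rewrite fg.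
Qed.

Lemma local_lift_eq_partial f x g h i a :
  local_lift f x g -> local_lift f x h ->
  partial i (fun z => g z 0 a) x = partial i (fun z => h z 0 a) x.
Proof.
move=> [U [Ux gs gf]] [V [Vx hs hf]].
have cg : {for x, continuous (fun z => g z 0 a)}.
  by have /= [+ _] := gs a 0%N; apply; case: Ux.
have ch : {for x, continuous (fun z => h z 0 a)}.
  by have /= [+ _] := hs a 0%N; apply; case: Vx.
pose d z := g z 0 a - h z 0 a.
have cd : d z @[z --> x] --> d x by exact: cvgB cg ch.
have dint z : U z -> V z -> exists k : int, d z = 2 * pi * k%:~R.
  move=> Uz Vz.
  have /to_torus4P[k /matrixP/(_ 0 a)] : to_torus4 (g z) = to_torus4 (h z).
    by rewrite gf// hf.
  by rewrite !mxE => kE; exists (k 0 a).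
have pi2 : 0 < 2 * pi :> R by rewrite mulr_gt0// pi_gt0.
have [Ux' Vx'] : U x /\ V x by split; [case: Ux|case: Vx].
have dE : \forall z \near x, g z 0 a = h z 0 a + d x.
  near=> z.
  have [Uz Vz] : U z /\ V z.
    by split; near: z; apply: open_nbhs_nbhs.
  have [k kE] := dint _ Uz Vz; have [l lE] := dint _ Ux' Vx'.
  have dzx : `|d x - d z| < 2 * pi.
    by near: z; move/cvgr_dist_lt: cd; apply.
  suff dzx0 : d z = d x by rewrite -dzx0 /d addrC subrK.
  move: dzx; rewrite kE lE -mulrBr -rmorphB normrM gtr0_norm// -[ltRHS]mulr1.
  rewrite ltr_pM2l// -intr_norm -[1]/(1%:~R) ltr_int => kl.
  by congr (_ * _%:~R); lia.
rewrite /partial (near_eq_derive _ dE); apply: derive_shift_ext => t.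
by rewrite opprD addrACA subrr addr0.
Unshelve. all: by end_near.
Qed.

Lemma torus_partialE f x g i a : local_lift f x g ->
  torus_partial f i a x = partial i (fun z => g z 0 a) x.
Proof.
move=> fg; rewrite /torus_partial; apply: local_lift_eq_partial (fg).
exact: (xgetPex (fun=> 0) (ex_intro _ _ fg)).
Qed.

End Smooth.

Section FourierMukai.
Variable R : realType.

Definition FM_curvature (f : 'rV[R]_3 -> torus4 R)
    (p : 'rV[R]_3 * torus4 R) : ext_form R[i] 7 :=
  'i *: \sum_(i < 3) \sum_(a < 4)
    (torus_partial f i a p.1)%:C *: (e7 R[i] i.+1 \w e7 R[i] a.+4).

(* The curvature sqrt(-1) dA of the connection d + sqrt(-1) A, for a real
   1-form A = sum_k A_k e^k in local coordinates z on X *)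
Definition connection_curvature (A : 'rV[R]_7 -> 'rV[R]_7) (z : 'rV[R]_7) :
    ext_form R[i] 7 :=
  'i *: \sum_(j < 7) \sum_(k < 7 | (j < k)%N)
    (partial j (fun t => A t 0 k) z - partial k (fun t => A t 0 j) z)%:C
    *: (covector R[i] j \w covector R[i] k).

(* The real Fourier--Mukai transform of the graph of f is locally
   d + sqrt(-1) sum_a g^a dy^a, with g a lift of f. *)
Definition FM_potential (g : 'rV[R]_3 -> 'rV[R]_4) (z : 'rV[R]_(3 + 4)) :
    'rV[R]_(3 + 4) :=
  row_mx 0 (g (lsubmx z)).

Lemma lsubmxDZ m n h (u v : 'rV[R]_(m + n)) :
  lsubmx (h *: u + v) = h *: lsubmx u + lsubmx v.
Proof. by apply/matrixP => i j; rewrite !mxE. Qed.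

Lemma partial_FM_dx (g : 'rV[R]_3 -> 'rV[R]_4) (j : 'I_7) (i : 'I_3) z :
  partial j (fun t => FM_potential g t 0 (lshift 4 i)) z = 0.
Proof.
rewrite /partial (_ : (fun t => _) = cst 0) ?derive_cst//.
by apply/funext => t; rewrite /FM_potential row_mxEl mxE.
Qed.

Lemma partial_FM_dy (g : 'rV[R]_3 -> 'rV[R]_4) (a : 'I_4) (k : 'I_7) z :
  partial (rshift 3 a) (fun t => FM_potential g t 0 k) z = 0.
Proof.
rewrite /partial -(derive_cst (0 : R) z (0 : 'rV[R]_7)).
apply: derive_shift_ext => h; rewrite /cst subrr /FM_potential lsubmxDZ.
rewrite (_ : lsubmx (delta_mx 0 (rshift 3 a)) = 0 :> 'rV_3); last first.
  by apply/matrixP => u v; rewrite !mxE eq_lrshift andbF.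
by rewrite scaler0 add0r subrr.
Qed.

Lemma partial_FM_dxdy (g : 'rV[R]_3 -> 'rV[R]_4) (i : 'I_3) (a : 'I_4)
   (x : 'rV_3) (y : 'rV_4) :
  partial (lshift 4 i : 'I_7) (fun t => FM_potential g t 0 (rshift 3 a))
    (row_mx x y : 'rV_7) =
  partial i (fun x => g x 0 a) x.
Proof.
apply: derive_shift_ext => h; rewrite /FM_potential !row_mxEr lsubmxDZ row_mxKl.
rewrite (_ : lsubmx (delta_mx 0 (lshift 4 i)) = delta_mx 0 i :> 'rV_3)//.
by apply/matrixP => u v; rewrite !mxE eq_lshift.
Qed.

Lemma connection_curvature_FM f p g (y : 'rV[R]_4) : local_lift f p.1 g ->
  connection_curvature (FM_potential g) (row_mx p.1 y) = FM_curvature f p.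
Proof.
move=> fg; rewrite /connection_curvature /FM_curvature; congr (_ *: _).
rewrite (@big_split_ord _ _ _ 3 4) /= [X in _ + X]big1 ?addr0.
  apply: eq_bigr => i _.
  rewrite big_mkcond (@big_split_ord _ _ _ 3 4) /= [X in X + _]big1 ?add0r.
    apply: eq_bigr => a _.
    rewrite ifT; last by move: (ltn_ord i); lia.
    rewrite partial_FM_dxdy partial_FM_dx subr0 (torus_partialE _ _ fg).
    rewrite /e7; do 2?congr (_ *: (covector _ _ \w covector _ _)).
      by apply/val_inj; rewrite /= inordK//= ltnW// ltnS;
        have := ltn_ord i; lia.
    by apply/val_inj; rewrite /= inordK//=; have := ltn_ord a; lia.
  by move=> k _; rewrite !partial_FM_dx subrr scale0r if_same.
move=> a _; apply: big1 => k; rewrite -(@fintype.splitK 3 4 k).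
case: (@fintype.split 3 4 k) => [i|b] /=.
  by have := ltn_ord i; lia.
by move=> _; rewrite !partial_FM_dy subrr scale0r.
Qed.

Lemma FM_curvature_sharp f (p : 'rV[R]_3 * torus4 R) :
  exists A, is_sharp (- 'i *: FM_curvature f p) A.
Proof.
apply: is_sharp_exists => S.
rewrite /FM_curvature scalerA mulNr -expr2 sqrCi opprK scale1r sum_ffunE.
apply: rpred_sum => i _; rewrite sum_ffunE; apply: rpred_sum => a _.
rewrite ffunE; apply: rpredM; first by apply/complex_realP; eexists.
by apply: real_wedge => T; rewrite ffunE ?realn.
Qed.

End FourierMukai.

(* Main.v *)
(* Write F = sqrt(-1) alpha with alpha = sum v_(ia) dx^i /\ dy^a real. In block
   form id + alpha^sharp is [[1, -M], [M^T, 1]] with M = (v_(ia)), so its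
   determinant is det (1 + M M^T), i.e. 1 plus the sum of the squares of all
   minors of M. The forms alpha^2 / 2 and alpha^3 / 6 have the 2- and 3-minors
   of M as coefficients, so the left-hand side is also an explicit polynomial
   in the v_(ia): the forms are computed in the exterior algebra on lists of
   monomials, and the two polynomials are compared as such. *)
Require Import Defs.
From mathcomp Require Import all_boot all_order all_algebra.
From mathcomp Require Import ring complex.
From mathcomp Require Import all_classical all_reals all_analysis.
Import Order.TTheory GRing.Theory Num.Theory.
Import numFieldNormedType.Exports.
Local Open Scope complex_scope.
Local Open Scope ring_scope.

(** * Bilinearity of the wedge product and linearity of the Hodge star *)

Section WedgeBilinear.
Context {K : comNzRingType} {n : nat}.
Implicit Types a b c : ext_form K n.

Lemma wedgeDl a b c : (a + b) \w c = a \w c + b \w c.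
Proof.
apply/ffunP => S; rewrite !ffunE -big_split /=.
by apply: eq_bigr => T _; rewrite ffunE mulrDl mulrDr.
Qed.

Lemma wedgeDr a b c : a \w (b + c) = a \w b + a \w c.
Proof.
apply/ffunP => S; rewrite !ffunE -big_split /=.
by apply: eq_bigr => T _; rewrite ffunE !mulrDr.
Qed.

Lemma wedgeZl (k : K) a b : (k *: a) \w b = k *: (a \w b).
Proof.
apply/ffunP => S; rewrite !ffunE scaler_sumr.
by apply: eq_bigr => T _; rewrite ffunE /GRing.scale /=; ring.
Qed.

Lemma wedgeZr (k : K) a b : a \w (k *: b) = k *: (a \w b).
Proof.
apply/ffunP => S; rewrite !ffunE scaler_sumr.
by apply: eq_bigr => T _; rewrite ffunE /GRing.scale /=; ring.
Qed.

Lemma wedge0l b : 0 \w b = 0.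
Proof. by rewrite -[X in X \w _](scale0r b) wedgeZl scale0r. Qed.

Lemma wedge0r b : b \w 0 = 0.
Proof. by rewrite -[X in _ \w X](scale0r b) wedgeZr scale0r. Qed.

Lemma wedge_suml (I : Type) (r : seq I) (F : I -> ext_form K n) b :
  (\sum_(i <- r) F i) \w b = \sum_(i <- r) (F i \w b).
Proof. exact: (big_morph (fun a => a \w b) (fun a c => wedgeDl a c b) (wedge0l b)). Qed.

Lemma wedge_sumr (I : Type) (r : seq I) (F : I -> ext_form K n) b :
  b \w (\sum_(i <- r) F i) = \sum_(i <- r) (b \w F i).
Proof. exact: (big_morph (wedge_form b) (wedgeDr b) (wedge0r b)). Qed.

Lemma wedge_powZ (k : K) a d : wedge_pow (k *: a) d = k ^+ d *: wedge_pow a d.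
Proof.
elim: d => [|d IH]; first by rewrite expr0 scale1r.
by rewrite /wedge_pow !iterS -/(wedge_pow _ d) IH wedgeZl wedgeZr scalerA -exprS.
Qed.

(** Complements [wedge_basis_form]: at [U] the product pairs [S] only with [U :\: S], which cannot
    be [T] when [S] and [T] meet. *)
Lemma wedge_basis_form0 (S T : {set 'I_n}) :
  ~~ [disjoint S & T] -> basis_form K S \w basis_form K T = 0.
Proof.
move=> /negP dST; apply/ffunP => U; rewrite !ffunE big1// => V _.
rewrite !ffunE; case: eqP => [->|]; last by rewrite mul0r mulr0.
case: eqP => [UT|]; last by rewrite !mulr0.
by case: dST; rewrite -UT disjoint_sym finset.disjoints_subset
  finset.setDE finset.subsetIr.
Qed.

Lemma hodgeD a b : hodge (a + b) = hodge a + hodge b.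
Proof. by apply/ffunP => S; rewrite !ffunE mulrDr. Qed.

Lemma hodgeZ (k : K) a : hodge (k *: a) = k *: hodge a.
Proof. by apply/ffunP => S; rewrite !ffunE /GRing.scale /=; ring. Qed.

Lemma hodge_sum (I : Type) (r : seq I) (F : I -> ext_form K n) :
  hodge (\sum_(i <- r) F i) = \sum_(i <- r) hodge (F i).
Proof.
apply: (big_morph _ hodgeD).
by rewrite -[X in hodge X](scale0r 0) hodgeZ scale0r.
Qed.

Lemma hodge_basis_form (S : {set 'I_n}) :
  hodge (basis_form K S) = wsign K S (~: S) *: basis_form K (~: S).
Proof.
apply/ffunP => T; rewrite !ffunE /GRing.scale /=.
rewrite (can2_eq (@finset.setCK _) (@finset.setCK _)).
by case: eqP => [->|]; rewrite ?finset.setCK// !mulr0.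
Qed.

End WedgeBilinear.

(* A form with polynomial coefficients is encoded as a list of terms
   (m, (b, [:: k1; ..; kd])), standing for (-1)^b v_k1 ... v_kd e^S, where
   S is the set of positions at which the bit mask m is true. *)
Definition coef_data := (bool * seq nat)%type.
Definition form_data := seq (seq bool * coef_data).

(** * Computable exterior algebra on lists of signed monomials *)

Section MaskOperations.
Variable n : nat.
Implicit Types (s : seq bool) (l : form_data).

(** Equality of the denoted subsets of ['I_n], not of lists: positions from [n] on are ignored and
    missing ones read as [false]. *)
Definition mask_eq s (t : seq bool) :=
  all (fun i => nth false s i == nth false t i) (iota 0 n).
Definition mask_disj s (t : seq bool) :=
  all (fun i => ~~ (nth false s i && nth false t i)) (iota 0 n).
Definition mask_union s (t : seq bool) :=
  mkseq (fun i => nth false s i || nth false t i) n.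
Definition mask_compl s := mkseq (fun i => ~~ nth false s i) n.
(** Parity of the number of inversions, the exponent in [wsign]. *)
Definition mask_sign s (t : seq bool) : bool :=
  odd (sumn [seq sumn [seq nat_of_bool [&& nth false s i, nth false t j & (j < i)%N]
                      | j <- iota 0 n] | i <- iota 0 n]).

Definition data_covector k : form_data :=
  [:: (mkseq (fun i => i == k) n, (false, [::]))].
Definition data_scale k l : form_data :=
  [seq (t.1, (t.2.1, k :: t.2.2)) | t <- l].
Definition data_opp l : form_data := [seq (t.1, (~~ t.2.1, t.2.2)) | t <- l].
(** Like terms are not collected, so multiplicities can be counted later; [mask_union] always
    returns a list of length [n], so equal sets get identical masks in the output. *)
Definition data_wedge l1 l2 : form_data :=
  flatten [seq [seq (mask_union t.1 u.1,
                      (mask_sign t.1 u.1 (+) (t.2.1 (+) u.2.1), t.2.2 ++ u.2.2))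
               | u <- l2 & mask_disj t.1 u.1] | t <- l1].
Definition data_hodge l : form_data :=
  [seq (mask_compl t.1, (mask_sign t.1 (mask_compl t.1) (+) t.2.1, t.2.2))
  | t <- l].
Definition data_pow l k : form_data :=
  iter k (data_wedge l) [:: (nseq n false, (false, [::]))].
Definition data_sort l : form_data :=
  [seq (t.1, (t.2.1, sort leq t.2.2)) | t <- l].
Definition data_at s l : seq coef_data := [seq t.2 | t <- l & mask_eq t.1 s].
Definition data_covered (U : seq (seq bool)) l : bool :=
  all (fun t => has (mask_eq t.1) U) l.
Definition masks_distinct (U : seq (seq bool)) : bool :=
  pairwise (fun s t => ~~ mask_eq s t) U.
Definition data_dot (U : seq (seq bool)) l1 l2 :=
  [seq (data_at s l1, data_at s l2) | s <- U].

End MaskOperations.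

Lemma foldr_big (T I : Type) (idx : T) (op : T -> T -> T) (F : I -> T) r :
  foldr (fun i x => op (F i) x) idx r = \big[op/idx]_(i <- r) F i.
Proof. by elim: r => [|i r IH]; rewrite ?big_nil// big_cons -IH. Qed.

(** * Correctness of the list operations under evaluation at [v] *)

Section Evaluation.
Context {K : comNzRingType} {n : nat} (v : nat -> K).
Implicit Types (s : seq bool) (l : form_data).

(** Written with [foldr], here and in the next two definitions, so that on a literal list
    simplification yields an explicit ring expression. *)
Definition mono_val (c : coef_data) : K :=
  let m := foldr (fun k x => v k * x) 1 c.2 in if c.1 then - m else m.
Definition coef_val (l : seq coef_data) : K :=
  foldr (fun c x => mono_val c + x) 0 l.
Definition dot_val (d : seq (seq coef_data * seq coef_data)) : K :=
  foldr (fun p x => coef_val p.1 * coef_val p.2 + x) 0 d.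

Definition mask_set s : {set 'I_n} := [set i : 'I_n | nth false s i].
Definition form_val l : ext_form K n :=
  \sum_(t <- l) mono_val t.2 *: basis_form K (mask_set t.1).

Lemma all_iota_ord (P : pred nat) : all P (iota 0 n) = [forall i : 'I_n, P i].
Proof.
apply/allP/forallP => [h i|h i]; first by apply: h; rewrite mem_iota /= ltn_ord.
by rewrite mem_iota /= add0n => ilt; have := h (Ordinal ilt).
Qed.

Lemma mask_set_eq s (t : seq bool) : (mask_set s == mask_set t) = mask_eq n s t.
Proof.
rewrite /mask_eq all_iota_ord; apply/eqP/forallP => [st i|st].
  by have /finset.setP/(_ i) := st; rewrite !finset.inE => ->.
by apply/finset.setP => i; rewrite !finset.inE; apply/eqP.
Qed.

Lemma mask_set_disj s (t : seq bool) :
  [disjoint mask_set s & mask_set t] = mask_disj n s t.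
Proof.
rewrite /mask_disj all_iota_ord -finset.setI_eq0; apply/eqP/forallP => [st i|st].
  by have /finset.setP/(_ i) := st; rewrite !finset.inE => ->.
by apply/finset.setP => i; rewrite !finset.inE; apply/negbTE.
Qed.

Lemma mask_set_union s (t : seq bool) :
  mask_set (mask_union n s t) = mask_set s :|: mask_set t.
Proof. by apply/finset.setP => i; rewrite !finset.inE nth_mkseq. Qed.

Lemma mask_set_compl s : mask_set (mask_compl n s) = ~: mask_set s.
Proof. by apply/finset.setP => i; rewrite !finset.inE nth_mkseq. Qed.

Lemma wsign_mask_set s (t : seq bool) :
  wsign K (mask_set s) (mask_set t) = (-1) ^+ mask_sign n s t.
Proof.
rewrite /wsign /mask_sign signr_odd; congr (_ ^+ _).
rewrite sumnE big_map -[n in iota 0 n]subn0 big_mkord -sum1_card big_mkcond /=.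
under [RHS]eq_bigr do rewrite sumnE big_map subn0 -[n in iota 0 n]subn0 big_mkord.
rewrite pair_big /=; apply: eq_bigr => -[i j] _.
by rewrite !finset.inE /=; case: ifP.
Qed.

Lemma mono_valE b (l : seq nat) :
  mono_val (b, l) = (-1) ^+ b * \prod_(k <- l) v k.
Proof. by rewrite /mono_val /= foldr_big; case: b; rewrite ?expr0 ?mul1r ?mulN1r. Qed.

Lemma form_val_cat l1 l2 : form_val (l1 ++ l2) = form_val l1 + form_val l2.
Proof. exact: big_cat. Qed.

Lemma form_val_opp l : form_val (data_opp l) = - form_val l.
Proof.
rewrite /form_val big_map -sumrN; apply: eq_bigr => -[m [b s]] _ /=.
by rewrite !mono_valE -scaleNr -mulNr; case: b; rewrite /= ?expr0 ?expr1 ?opprK.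
Qed.

Lemma form_val_scale k l : form_val (data_scale k l) = v k *: form_val l.
Proof.
rewrite /form_val big_map scaler_sumr; apply: eq_bigr => -[m [b s]] _ /=.
by rewrite !mono_valE scalerA big_cons mulrCA.
Qed.

Lemma form_val_flatten k (g : nat -> form_data) :
  form_val (flatten [seq g i | i <- iota 0 k]) = \sum_(i < k) form_val (g i).
Proof.
by rewrite /form_val big_flatten big_map -[k in iota 0 k]subn0 big_mkord.
Qed.

Lemma form_val_covector (k : 'I_n) : form_val (data_covector n k) = covector K k.
Proof.
rewrite /form_val big_seq1 /mono_val /= scale1r /covector; congr basis_form.
by apply/finset.setP => i; rewrite !finset.inE nth_mkseq.
Qed.

Lemma form_val_wedge l1 l2 :
  form_val (data_wedge n l1 l2) = form_val l1 \w form_val l2.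
Proof.
rewrite /form_val big_flatten big_map wedge_suml; apply: eq_bigr => t _.
rewrite wedge_sumr big_map big_filter big_mkcond; apply: eq_bigr => u _.
rewrite wedgeZl wedgeZr scalerA -mask_set_disj.
case: ifPn => [d|/wedge_basis_form0 ->]; last by rewrite scaler0.
rewrite wedge_basis_form// scalerA /= mask_set_union; congr (_ *: _).
case: t u {d} => [m [b s]] [m' [b' s']] /=.
by rewrite !mono_valE wsign_mask_set big_cat !signr_addb /=; ring.
Qed.

Lemma form_val_hodge l : form_val (data_hodge n l) = hodge (form_val l).
Proof.
rewrite /form_val big_map hodge_sum; apply: eq_bigr => -[m [b s]] _ /=.
rewrite hodgeZ hodge_basis_form scalerA -mask_set_compl.
by rewrite wsign_mask_set !mono_valE signr_addb; congr (_ *: _); ring.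
Qed.

Lemma form_val_at l s : form_val l (mask_set s) = coef_val (data_at n s l).
Proof.
rewrite /form_val sum_ffunE /coef_val foldr_big /data_at big_map big_filter.
rewrite [RHS]big_mkcond; apply: eq_bigr => t _.
rewrite !ffunE eq_sym mask_set_eq /GRing.scale /=.
by case: ifP; rewrite ?mulr1 ?mulr0.
Qed.

(** Lets a sum over all subsets of ['I_n] be cut down to the masks listed in [U]. *)
Lemma form_val_notin U l S : data_covered n U l ->
  S \notin [seq mask_set s | s <- U] -> form_val l S = 0.
Proof.
move=> /allP cov SU; rewrite /form_val sum_ffunE big_seq big1// => t tl.
rewrite !ffunE; case: eqP => [St|_]; last by rewrite scaler0.
have /hasP[s sU] := cov _ tl; rewrite -mask_set_eq => /eqP ts.
by case/negP: SU; rewrite St ts map_f.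
Qed.

(** Since [K] is commutative, sorting the variables of a monomial keeps its value; what remains is a
    count of terms, decidable by computation and requiring no inverse of [k]. *)
Lemma form_val_multiple k l1 l2 :
  perm_eq (data_sort l1) (flatten (nseq k l2)) ->
  form_val l1 = k%:R *: form_val l2.
Proof.
move=> l12; have -> : form_val l1 = form_val (data_sort l1).
  rewrite /form_val big_map; apply: eq_bigr => -[m [b s]] _ /=.
  by rewrite !mono_valE; congr (_ * _ *: _); apply/esym/perm_big; rewrite perm_sort.
rewrite /form_val (perm_big _ l12) /= big_flatten.
elim: k {l12} => [|k IH]; rewrite ?big_nil ?scale0r//= big_cons IH.
by rewrite -nat1r scalerDl scale1r.
Qed.

Lemma form_val_one :
  form_val [:: (nseq n false, (false, [::]))] = basis_form K finset.set0.
Proof.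
rewrite /form_val big_seq1 /mono_val /= scale1r; congr basis_form.
by apply/finset.setP => i; rewrite !finset.inE nth_nseq if_same.
Qed.

Lemma form_val_pow l k :
  form_val (data_pow n l k) = wedge_pow (form_val l) k.
Proof.
elim: k => [|k IH]; first exact: form_val_one.
by rewrite /data_pow /wedge_pow !iterS form_val_wedge -/(data_pow _ _ _) IH.
Qed.

Lemma masks_distinct_uniq U :
  masks_distinct n U -> uniq [seq mask_set s | s <- U].
Proof.
rewrite uniq_pairwise pairwise_map; congr is_true.
by apply: eq_pairwise => s t /=; rewrite mask_set_eq.
Qed.

End Evaluation.

(** * Inner products and norms of encoded forms *)

Lemma form_norm_sqr (R : realType) n (a : ext_form R[i] n) :
  form_norm a ^+ 2 = form_dot a a.
Proof. exact: sqrtCK. Qed.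

Lemma form_dotZ (R : realType) n (k k' : R[i]) (a b : ext_form R[i] n) :
  form_dot (k *: a) (k' *: b) = k * k'^* * form_dot a b.
Proof.
rewrite /form_dot mulr_sumr; apply: eq_bigr => S _.
by rewrite !ffunE /GRing.scale /= rmorphM /=; ring.
Qed.

(** Real variables make the conjugation trivial. A product of coefficients vanishes wherever that of
    [l2] does, so covering [l2] suffices; distinctness of the masks prevents double counting. *)
Lemma form_dot_val (R : realType) n (v : nat -> R[i]) U l1 l2 :
  (forall k, v k \is Num.real) -> masks_distinct n U -> data_covered n U l2 ->
  form_dot (form_val v l1 : ext_form _ n) (form_val v l2) =
  dot_val v (data_dot n U l1 l2).
Proof.
move=> vr dU cU; rewrite /form_dot (bigID (mem [seq mask_set s | s <- U])) /=.
rewrite [X in _ + X]big1 ?addr0; last first.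
  by move=> S /(form_val_notin _ _ _ _ cU) ->; rewrite rmorph0 mulr0.
rewrite -big_uniq /=; last exact: masks_distinct_uniq.
rewrite /dot_val foldr_big !big_map; apply: eq_bigr => s _ /=.
rewrite !form_val_at; congr (_ * _); apply: conj_Creal.
rewrite /coef_val foldr_big; apply: rpred_sum => -[b m] _.
by rewrite mono_valE rpredM ?rpredX ?rpredN ?rpred1// rpred_prod.
Qed.

(** * The forms of the theorem as data, and the polynomial identity *)

Section FourierMukaiData.

Definition data_e7 k : form_data := data_covector 7 k.-1.

Definition data_phi : form_data :=
  let w := data_wedge 7 in let e := data_e7 in
  w (w (e 1) (e 2)) (e 3)
  ++ (w (e 1) (w (e 4) (e 5) ++ w (e 6) (e 7))
  ++ w (e 2) (w (e 4) (e 6) ++ w (e 7) (e 5))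
  ++ w (e 3) (data_opp (w (e 4) (e 7) ++ w (e 5) (e 6)))).

(* [alpha = sum_(i, a) v_(4 i + a) dx^(i + 1) /\ dy^(a + 4)] *)
Definition data_alpha : form_data :=
  flatten [seq flatten [seq
    data_scale (4 * i + a) (data_wedge 7 (data_e7 i.+1) (data_e7 a.+4))
    | a <- iota 0 4] | i <- iota 0 3].

Definition data_alpha2 := data_pow 7 data_alpha 2.
Definition data_alpha3 := data_pow 7 data_alpha 3.

(* Every monomial of alpha^k occurs k! times, once for each ordering of its
   variables; keeping the sorted ones divides by k!. *)
Definition data_sorted (l : form_data) := [seq t <- l | sorted ltn t.2.2].

Definition masks_of (l : form_data) := undup (unzip1 l).

(* [* phi /\ alpha - alpha^3 / 6] *)
Definition data_dDT : form_data :=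
  data_wedge 7 (data_hodge 7 data_phi) data_alpha
  ++ data_opp (data_sorted data_alpha3).
(* [phi /\ * (alpha^2 / 2)] *)
Definition data_phi_star_sq : form_data :=
  data_wedge 7 data_phi (data_hodge 7 (data_sorted data_alpha2)).

(** This and the next two are stored in normal form, so that [gram_identity] starts from literal
    lists. *)
Definition data_dot_scalar :=
  Eval vm_compute in data_dot 7 (masks_of (data_hodge 7 data_phi))
    (data_sorted data_alpha2) (data_hodge 7 data_phi).
Definition data_dot_dDT :=
  Eval vm_compute in data_dot 7 (masks_of data_dDT) data_dDT data_dDT.
Definition data_dot_phi_star_sq :=
  Eval vm_compute in data_dot 7 (masks_of data_phi_star_sq)
    data_phi_star_sq data_phi_star_sq.

Context {K : comNzRingType} (v : nat -> K).

Lemma form_val_e7 k : (k.-1 < 7)%N -> form_val v (data_e7 k) = e7 K k.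
Proof.
move=> k7; rewrite /data_e7 /e7 -(form_val_covector v); congr (form_val v _).
by rewrite inordK.
Qed.

Lemma form_val_phi : form_val v data_phi = phi K.
Proof.
rewrite /data_phi /phi /omega1 /omega2 /omega3.
by rewrite !(form_val_cat, form_val_wedge, form_val_opp, form_val_e7)// !addrA.
Qed.

Lemma form_val_alpha : form_val v data_alpha =
  \sum_(i < 3) \sum_(a < 4) v (4 * i + a)%N *: (e7 K i.+1 \w e7 K a.+4).
Proof.
rewrite form_val_flatten; apply: eq_bigr => i _.
rewrite form_val_flatten; apply: eq_bigr => a _.
rewrite form_val_scale form_val_wedge !form_val_e7//=.
  by have := ltn_ord a; rewrite -[(a.+3 < 7)%N]/(a < 4)%N.
by apply: ltn_trans (ltn_ord i) _.
Qed.

(** Two-forms commute, so both orderings of a product of two terms of [alpha] carry the same sign,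
    and squares of terms vanish: the sorted product list is two copies of its increasing part. The
    cube works likewise with 3! = 6 orderings. *)
Lemma wedge_pow_alpha2 : wedge_pow (form_val v data_alpha) 2 =
  2 *: form_val v (data_sorted data_alpha2) :> ext_form K 7.
Proof. by rewrite -form_val_pow; apply: form_val_multiple; vm_compute. Qed.

Lemma wedge_pow_alpha3 : wedge_pow (form_val v data_alpha) 3 =
  6 *: form_val v (data_sorted data_alpha3) :> ext_form K 7.
Proof. by rewrite -form_val_pow; apply: form_val_multiple; vm_compute. Qed.

Lemma form_val_dDT : form_val v data_dDT =
  hodge (phi K) \w form_val v data_alpha - form_val v (data_sorted data_alpha3).
Proof.
by rewrite form_val_cat form_val_opp form_val_wedge form_val_hodge form_val_phi.
Qed.

Lemma form_val_phi_star_sq : form_val v data_phi_star_sq =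
  phi K \w hodge (form_val v (data_sorted data_alpha2)).
Proof. by rewrite form_val_wedge form_val_hodge form_val_phi. Qed.

(** The theorem for [alpha] with the factors of sqrt(-1) and the factorials removed. Both sides have
    integer coefficients in the twelve variables, so the identity holds over any commutative
    ring. *)
Lemma gram_identity :
  let M : 'M[K]_(3, 4) := \matrix_(i, a) v (4 * i + a)%N in
  (1 - dot_val v data_dot_scalar) ^+ 2 + dot_val v data_dot_dDT
    + dot_val v data_dot_phi_star_sq = \det (1%:M + M *m M^T).
Proof.
move=> M.
rewrite (expand_det_row _ ord0) !big_ord_recl big_ord0 /cofactor.
rewrite !(expand_det_row _ ord0) !big_ord_recl !big_ord0 /cofactor !det_mx11.
rewrite !mxE !big_ord_recl !big_ord0 !mxE.
(* The right-hand side is now fully expanded along rows; unfolding the evaluators on the literal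
   lists makes the left-hand side an explicit polynomial too. *)
rewrite /dot_val /coef_val /mono_val /=.
ring.
Qed.

End FourierMukaiData.

(** * The determinant and the endomorphism dual to [alpha] *)

(** Schur complement of the lower right identity block: a unipotent lower triangular factor splits
    off. *)
Lemma det_skew_block (K : comNzRingType) m n (M : 'M[K]_(m, n)) :
  \det (1%:M + block_mx 0 (- M) M^T 0) = \det (1%:M + M *m M^T).
Proof.
have -> : 1%:M + block_mx 0 (- M) M^T 0 =
    block_mx (1%:M + M *m M^T) (- M) 0 1%:M *m block_mx 1%:M 0 M^T 1%:M.
  rewrite mulmx_block scalar_mx_block add_block_mx.
  congr block_mx;
    by rewrite ?mulmx1 ?mul1mx ?mulmx0 ?mul0mx ?mulNmx ?addrK ?addr0 ?add0r.
by rewrite det_mulmx det_ublock det_lblock !det1 !mulr1.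
Qed.

Section Eval2.
Context {R : realType} {n : nat}.
Implicit Types (w : ext_form R[i] n) (x y : 'cV[R]_n).

Lemma eval2_sum (I : Type) (r : seq I) (F : I -> ext_form R[i] n) x y :
  eval2 (\sum_(i <- r) F i) x y = \sum_(i <- r) eval2 (F i) x y.
Proof.
rewrite /eval2 exchange_big; apply: eq_bigr => j _.
rewrite exchange_big; apply: eq_bigr => k _.
by rewrite sum_ffunE mulr_suml.
Qed.

Lemma eval2Z (c : R[i]) w x y : eval2 (c *: w) x y = c * eval2 w x y.
Proof.
rewrite /eval2 mulr_sumr; apply: eq_bigr => j _.
rewrite mulr_sumr; apply: eq_bigr => k _.
by rewrite ffunE mulrA.
Qed.

(** With [i < j] there is no inversion, so the sign is 1, and [(i, j)] is the only increasing pair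
    with underlying set [[set i; j]]. *)
Lemma eval2_wedge_covector (i j : 'I_n) x y : (i < j)%N ->
  eval2 (covector R[i] i \w covector R[i] j) x y =
  (x i 0 * y j 0 - x j 0 * y i 0)%:C.
Proof.
move=> ij.
have -> : covector R[i] i \w covector R[i] j = basis_form R[i] [set i; j].
  rewrite wedge_basis_form; last by rewrite disjoints1 finset.inE neq_ltn ij.
  rewrite /wsign (_ : [set p | _] = finset.set0) ?cards0 ?scale1r//.
  apply/finset.setP => -[k l]; rewrite !finset.inE /=; apply/and3P => -[/eqP-> /eqP->].
  by rewrite ltnNge ltnW.
rewrite /eval2 (bigD1 i)//= [X in _ + X]big1 ?addr0 => [|k ki].
  rewrite (bigD1 j)//= [X in _ + X]big1 ?addr0 => [|l /andP[il lj]].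
    by rewrite ffunE eqxx mul1r.
  rewrite ffunE; case: eqP => [E|]; last by rewrite mul0r.
  have : l \in [set i; j] by rewrite -E !finset.inE eqxx orbT.
  by rewrite !finset.inE (negbTE lj) orbF => /eqP li; rewrite li ltnn in il.
(* For [k] other than [i], equality of the sets forces [k = j] and [l = i], against [k < l]. *)
rewrite big1// => l kl; rewrite ffunE; case: eqP => [E|]; last by rewrite mul0r.
have : k \in [set i; j] by rewrite -E !finset.inE eqxx.
rewrite !finset.inE (negbTE ki) /= => /eqP kj.
have : i \in [set k; l] by rewrite E !finset.inE eqxx.
rewrite !finset.inE eq_sym (negbTE ki) /= => /eqP il.
by move: kl; rewrite kj -il ltnNge ltnW.
Qed.

End Eval2.

(** In the pairing of [A x] with [y], the block [M^T] sends the dx-part of [x] to the dy-part and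
    gives the terms [x_i y_a]; the block [- M] gives [- x_a y_i]. *)
Lemma alpha_is_sharp (R : realType) (m : nat -> R) :
  let M : 'M[R]_(3, 4) := \matrix_(i, a) m (4 * i + a)%N in
  is_sharp (form_val (fun k => (m k)%:C) data_alpha)
    (block_mx 0 (- M) M^T 0 : 'M[R]_7).
Proof.
move=> M x y; rewrite form_val_alpha eval2_sum.
have -> : ((block_mx 0 (- M) M^T 0 *m (x : 'cV[R]_(3 + 4)))^T
             *m (y : 'cV[R]_(3 + 4))) 0 0 =
    \sum_(i < 3) \sum_(a < 4) m (4 * i + a)%N *
      (x (lshift 4 i : 'I_7) 0 * y (rshift 3 a : 'I_7) 0
       - x (rshift 3 a : 'I_7) 0 * y (lshift 4 i : 'I_7) 0).
  rewrite mxE big_split_ord /=.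
  under eq_bigr => i _.
    rewrite !mxE big_split_ord /= big1 ?add0r; last first.
      by move=> j _; rewrite block_mxEul mxE mul0r.
    under eq_bigr do rewrite block_mxEur !mxE.
    rewrite mulr_suml; over.
  under [X in _ + X]eq_bigr => a _.
    rewrite !mxE big_split_ord /= [X in _ + X]big1 ?addr0; last first.
      by move=> j _; rewrite block_mxEdr mxE mul0r.
    under eq_bigr do rewrite block_mxEdl !mxE.
    rewrite mulr_suml; over.
  rewrite [X in _ + X]exchange_big -big_split /=; apply: eq_bigr => i _.
  by rewrite -big_split /=; apply: eq_bigr => a _; ring.
rewrite rmorph_sum; apply: eq_bigr => i _.
rewrite rmorph_sum eval2_sum; apply: eq_bigr => a _.
(* [e7] counts from 1, so [e7 i.+1] and [e7 a.+4] sit at positions [i] and [3 + a]. *)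
have li : inord i = lshift 4 i :> 'I_7.
  by apply/val_inj; rewrite /= inordK// (leq_trans (ltn_ord i)).
have ra : inord a.+3 = rshift 3 a :> 'I_7.
  by apply/val_inj; rewrite /= inordK//; have := ltn_ord a.
rewrite rmorphM eval2Z /e7 /= li ra eval2_wedge_covector//=.
by rewrite (leq_trans (ltn_ord i))// leq_addr.
Qed.

(** * Reduction of the curvature identity to the polynomial one *)

Local Open Scope classical_set_scope.
Local Open Scope complex_scope.
Local Open Scope ring_scope.

Theorem lemma4p3 (R : realType) (B : set 'rV[R]_3) (B_open : open B)
    (f : 'rV[R]_3 -> torus4 R) (f_smooth : smooth_to_torus B f)
    (p : 'rV[R]_3 * torus4 R) (Bp : B p.1)
    (A : 'M[R]_7) (A_sharp : is_sharp (- 'i *: FM_curvature f p) A) :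
  let F := FM_curvature f p in
  let phi := phi R[i] in
  (1 + 2^-1 * form_dot (wedge_pow F 2) (hodge phi)) ^+ 2
  + form_norm (hodge phi \w F + 6^-1 *: wedge_pow F 3) ^+ 2
  + 4^-1 * form_norm (phi \w hodge (wedge_pow F 2)) ^+ 2
  = (\det (1%:M + A))%:C.
Proof.
move=> F phi0.
(* Division by 4 inverts the numbering [4 * i + a] of the variables in [data_alpha]. *)
pose m k : R := torus_partial f (inord (k %/ 4)) (inord (k %% 4)) p.1.
pose v k : R[i] := (m k)%:C.
have vr k : v k \is Num.real by apply/complex_realP; eexists.
have vE (i : 'I_3) (a : 'I_4) : v (4 * i + a)%N = (torus_partial f i a p.1)%:C.
  rewrite /v /m mulnC divnMDl// divn_small// addn0 modnMDl modn_small//.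
  by rewrite !inord_val.
have FE : F = 'i *: form_val v data_alpha.
  rewrite form_val_alpha /F /FM_curvature; congr (_ *: _).
  by apply: eq_bigr => i _; apply: eq_bigr => a _; rewrite vE.
pose M : 'M[R]_(3, 4) := \matrix_(i, a) m (4 * i + a)%N.
(* As [- 'i * 'i = 1], the form [- 'i *: F] is [alpha], whose dual endomorphism is unique. *)
have AE : A = (block_mx 0 (- M) M^T 0 : 'M[R]_(3 + 4)).
  apply: is_sharp_unique A_sharp _.
  rewrite -/F FE scalerA mulNr -expr2 sqrCi opprK scale1r.
  exact: alpha_is_sharp.
have -> : \det (1%:M + A) = \det (1%:M + M *m M^T).
  by rewrite AE; exact: (@det_skew_block R 3 4 M).
(* The real determinant is moved into [R[i]], where the forms take their coefficients. *)
rewrite -[RHS]det_map_mx map_mxD map_mx1 map_mxM -matrix.map_trmx.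
have -> : map_mx (real_complex R) M = \matrix_(i, a) v (4 * i + a)%N.
  by apply/matrixP => i a; rewrite !mxE.
rewrite -(gram_identity v) /phi0 FE !wedge_powZ.
rewrite wedge_pow_alpha2 wedge_pow_alpha3 sqrCi.
have i3 : 'i ^+ 3 = - 'i :> R[i] by rewrite exprS sqrCi mulrN1.
have neq0 k : k.+1%:R != 0 :> R[i] by rewrite pnatr_eq0.
(* Since ['i ^+ 3 = - 'i], a common factor ['i] comes out and the cubic term changes sign. *)
have -> : hodge (phi _) \w ('i *: form_val v data_alpha) +
    6^-1 *: ('i ^+ 3 *: (6 *: form_val v (data_sorted data_alpha3))) =
    'i *: form_val v data_dDT.
  rewrite form_val_dDT wedgeZr scalerBr i3 !scalerA.
  by rewrite mulrAC mulVf// mul1r scaleNr.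
have -> : phi _ \w hodge (-1 *: (2 *: form_val v (data_sorted data_alpha2))) =
    - 2 *: form_val v data_phi_star_sq.
  by rewrite form_val_phi_star_sq scalerA hodgeZ wedgeZr mulN1r.
have dDT_norm : form_norm ('i *: form_val v data_dDT : ext_form _ 7) ^+ 2 =
    dot_val v data_dot_dDT.
  rewrite form_norm_sqr form_dotZ.
  rewrite (form_dot_val _ _ v (masks_of data_dDT) _ _ vr); [|by vm_compute..].
  (* The precomputed list replaces [data_dot] by conversion; the factor ['i] has squared modulus
     1. *)
  rewrite -[data_dot _ _ _ _]/data_dot_dDT conjCi mulrN -expr2 sqrCi opprK.
  exact: mul1r.
(* The factor [- 2] comes from ['i ^+ 2 = -1] and [alpha^2 = 2 (alpha^2 / 2)]; its square cancels
   the [4^-1] of the statement. *)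
have phi_star_norm :
    form_norm (- 2 *: form_val v data_phi_star_sq : ext_form _ 7) ^+ 2 =
    4 * dot_val v data_dot_phi_star_sq.
  rewrite form_norm_sqr form_dotZ.
  rewrite (form_dot_val _ _ v (masks_of data_phi_star_sq) _ _ vr); [|by vm_compute..].
  by rewrite conj_Creal ?rpredN ?realn// mulrNN -natrM.
have scalar_dot :
    form_dot (-1 *: (2 *: form_val v (data_sorted data_alpha2)) : ext_form _ 7)
    (hodge (phi _)) = - 2 * dot_val v data_dot_scalar.
  rewrite -(form_val_phi v) -form_val_hodge scalerA.
  rewrite -[X in form_dot _ X]scale1r form_dotZ.
  rewrite (form_dot_val _ _ v (masks_of (data_hodge 7 data_phi)) _ _ vr);
    [|by vm_compute..].
  by rewrite rmorph1 mulr1 mulN1r.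
congr (_ + _ + _).
- by rewrite scalar_dot mulrA mulrN mulVf// mulN1r.
- exact: dDT_norm.
- by rewrite [X in _ * X]phi_star_norm mulrA mulVf// mul1r.
Qed.
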